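(* Let $G$ be a finite abelian group and $n\in\mathbb{N}$. Then $\mathring{\mathcal P}_n(G)=\bigoplus_{\mathbf c^{\mathbf g}\in\mathring\Pi_n(G)}\mathbb{Z}\,\mathring p^{\,G}_{\mathbf c^{\mathbf g}}$ is a (non-unitary) subalgebra of the Mantaci-Reutenauer algebra $\Sigma_n(G)$; that is, $\mathring{\mathcal P}_n(G)$ is contained in $\Sigma_n(G)$ and is closed under the multiplication of the group algebra $\mathbb{Z}G_n$ (it is not required to contain the identity).
   Context: Write $[1,n]=\{1,\dots,n\}$. Permutations $\sigma\in\mathfrak S_n$ are written as words $\sigma(1)\cdots\sigma(n)$, and $(uv)(x)=u(v(x))$. Let $G_n=G^n\rtimes\mathfrak S_n$ be the wreath product of $G$ with $\mathfrak S_n$. An element of $G_n$ is denoted $\sigma^{\mathbf g}=\sigma\cdot(g_1,\dots,g_n)$, with $\sigma\in\mathfrak S_n$ and $\mathbf g=(g_1,\dots,g_n)\in G^n$, and is identified with the coloured word $\sigma(1)^{g_1}\cdots\sigma(n)^{g_n}$; multiplication is determined by $\sigma\cdot(g_1,\dots,g_n)=(g_{\sigma^{-1}(1)},\dots,g_{\sigma^{-1}(n)})\cdot\sigma$. The rainbow decomposition of a coloured word $w^{\mathbf g}$ is the unique factorization $w^{\mathbf g}=w_1^{g_1}\cdot w_2^{g_2}\cdots w_k^{g_k}$ into nonempty words $w_i$, all letters of $w_i$ having the single colour $g_i$, with $g_i\neq g_{i+1}$ for $1\le i<k$. The standardization $\mathrm{std}(w)$ of a word $w=a_1\cdots a_n$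 over a totally ordered alphabet is the unique $\sigma\in\mathfrak S_n$ such that for $i<j$: $\sigma(i)>\sigma(j)\iff a_i>a_j$. A composition of $n$ is a finite sequence of positive integers with sum $n$. A subset $I=\{i_1<\dots<i_k\}\subseteq[1,n-1]$ corresponds to the composition $\mathbf c_I=(i_1,i_2-i_1,\dots,i_k-i_{k-1},n-i_k)$ of $n$. For $\sigma\in\mathfrak S_n$ let $\mathrm{Des}(\sigma)=\{i\in[1,n-1]:\sigma(i)>\sigma(i+1)\}$ and $\mathring{\mathrm{peak}}(\sigma)=\{i\in[1,n-1]: i>1,\ \sigma(i-1)<\sigma(i)>\sigma(i+1)\}$; set $D(\sigma)=\mathbf c_{\mathrm{Des}(\sigma)}$ and $\mathring P(\sigma)=\mathbf c_{\mathring{\mathrm{peak}}(\sigma)}$, extended to words $w$ by $D(w)=D(\mathrm{std}(w))$, $\mathring P(w)=\mathring P(\mathrm{std}(w))$. For a composition $\mathbf c=(c_1,\dots,c_r)$ and $g\in G$, $\mathbf c^g$ denotes the word $c_1^g\cdots c_r^g$. A $G$-composition of $n$ is a finite word in letters $c^g$ ($c$ a positive integer, $g\in G$) with the integers summing to $n$. For $\sigma^{\mathbf g}\in G_n$ with rainbow decomposition $\sigma_1^{g_1}\cdots\sigma_k^{g_k}$, put (concatenations of words) $D_G(\sigma^{\mathbf g})=D(\sigma_1)^{g_1}\cdots D(\sigma_k)^{g_k}$ and $\mathring P_G(\sigma^{\mathbf g})=\mathring P(\sigma_1)^{g_1}\cdots\mathring P(\sigma_k)^{g_k}$. Let $\mathring\Pi_n(G)$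 be the set of all $\mathring P_G(\alpha)$, $\alpha\in G_n$. In $\mathbb{Z}G_n$ set $d^G_{\mathbf c^{\mathbf g}}=\sum_{D_G(\alpha)=\mathbf c^{\mathbf g}}\alpha$ and $\mathring p^{\,G}_{\mathbf c^{\mathbf g}}=\sum_{\mathring P_G(\alpha)=\mathbf c^{\mathbf g}}\alpha$. The Mantaci-Reutenauer algebra is $\Sigma_n(G)=\bigoplus_{\mathbf c^{\mathbf g}}\mathbb{Z}\,d^G_{\mathbf c^{\mathbf g}}$ (sum over all $G$-compositions of $n$), which is known to be a subalgebra of $\mathbb{Z}G_n$. *)

(* Defs.v *)
From HB Require Import structures.
From mathcomp Require Import all_boot all_order all_algebra all_fingroup.

Set Implicit Arguments.
Unset Strict Implicit.
Unset Printing Implicit Defensive.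

Import GRing.Theory.

(* For s t : 'S_n, MathComp's (t * s)%g is the permutation x |-> s (t x), that
   is, the product "s t" under the convention (uv)(x) = u(v(x)) used here. *)

Section WreathProduct.
Variables (n : nat) (G : finGroupType).

(* Wreath s g is the element s . (g_1, ..., g_n), with colours indexed by
   positions. *)
Record wreath := Wreath { wperm : 'S_n; wcol : {ffun 'I_n -> G} }.

Definition wreath_pair (a : wreath) := (wperm a, wcol a).
Definition pair_wreath (p : 'S_n * {ffun 'I_n -> G}) := Wreath p.1 p.2.

Lemma wreath_pairK : cancel wreath_pair pair_wreath.
Proof. by case. Qed.

HB.instance Definition _ := Finite.copy wreath (can_type wreath_pairK).

Local Open Scope group_scope.

Definition wreath_one : wreath := Wreath 1 [ffun=> 1].

(* (s . g)(t . h) = (s t) . (g_{t(1)} h_1, ..., g_{t(n)} h_n), by the rule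
   t . (k_1, ..., k_n) = (k_{t^-1(1)}, ..., k_{t^-1(n)}) . t. *)
Definition wreath_mul (a b : wreath) : wreath :=
  Wreath (wperm b * wperm a) [ffun i => wcol a (wperm b i) * wcol b i].

Definition wreath_inv (a : wreath) : wreath :=
  Wreath (wperm a)^-1 [ffun i => (wcol a ((wperm a)^-1 i))^-1].

Lemma wreath_mulA : associative wreath_mul.
Proof.
move=> [s g] [t h] [u k]; rewrite /wreath_mul /= mulgA; congr Wreath.
by apply/ffunP=> i; rewrite !ffunE permM mulgA.
Qed.

Lemma wreath_mul1 : left_id wreath_one wreath_mul.
Proof.
move=> [s g]; rewrite /wreath_mul /= mulg1; congr Wreath.
by apply/ffunP=> i; rewrite !ffunE mul1g.
Qed.

Lemma wreath_mulV : left_inverse wreath_one wreath_inv wreath_mul.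
Proof.
move=> [s g]; rewrite /wreath_mul /wreath_one /= mulgV; congr Wreath.
by apply/ffunP=> i; rewrite !ffunE permK mulVg.
Qed.

HB.instance Definition _ :=
  Finite_isGroup.Build wreath wreath_mulA wreath_mul1 wreath_mulV.

Lemma wreath_mulE (s t : 'S_n) (g h : {ffun 'I_n -> G}) :
  Wreath s g * Wreath t h = Wreath (t * s) [ffun i => g (t i) * h i].
Proof. by []. Qed.

Lemma wreath_factor (s : 'S_n) (g : {ffun 'I_n -> G}) :
  Wreath s g = Wreath s [ffun=> 1] * Wreath 1 g.
Proof.
rewrite !wreath_mulE mul1g; congr Wreath.
by apply/ffunP=> i; rewrite !ffunE mul1g.
Qed.

Lemma wreath_exchange (s : 'S_n) (g : {ffun 'I_n -> G}) :
  Wreath s [ffun=> 1] * Wreath 1 g =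
  Wreath 1 [ffun i => g (s^-1 i)] * Wreath s [ffun=> 1].
Proof.
rewrite !wreath_mulE mul1g mulg1; congr Wreath.
by apply/ffunP=> i; rewrite !ffunE permK mul1g mulg1.
Qed.

End WreathProduct.

Section GroupAlgebra.
Variable H : finGroupType.
Local Open Scope ring_scope.

(* The integral group algebra ZH: x : zgalg H is the formal sum of the
   x a . a, for a in H. The ring structure below is the convolution product,
   not the pointwise one of {ffun H -> int}. *)
Definition zgalg : Type := {ffun H -> int}.
HB.instance Definition _ := GRing.Zmodule.on zgalg.

Definition gbase (a : H) : zgalg := [ffun b => (b == a)%:R].

Definition gconv (x y : zgalg) : zgalg :=
  [ffun a => \sum_(b : H) x b * y (b^-1 * a)%g].

Lemma gconvA : associative gconv.
Proof.
move=> x y z; apply/ffunP=> a; rewrite !ffunE.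
under eq_bigr => b _ do rewrite ffunE mulr_sumr.
under [RHS]eq_bigr => b _ do rewrite ffunE mulr_suml.
rewrite [RHS]exchange_big /=; apply: eq_bigr => b _.
rewrite [RHS](reindex_inj (mulgI b)) /=; apply: eq_bigr => c _.
by rewrite mulKg invMg mulgA mulrA.
Qed.

Lemma gconv1 : left_id (gbase 1%g) gconv.
Proof.
move=> x; apply/ffunP=> a; rewrite ffunE (bigD1 1%g) //= big1 => [|b /negPf nb].
  by rewrite ffunE eqxx mul1r invg1 mul1g addr0.
by rewrite ffunE nb mul0r.
Qed.

Lemma gconvr1 : right_id (gbase 1%g) gconv.
Proof.
move=> x; apply/ffunP=> a; rewrite ffunE (bigD1 a) //= big1 => [|b nb].
  by rewrite ffunE mulVg eqxx mulr1 addr0.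
by rewrite ffunE -eq_mulVg1 (negPf nb) mulr0.
Qed.

Lemma gconvDl : left_distributive gconv +%R.
Proof.
move=> x y z; apply/ffunP=> a; rewrite !ffunE -big_split.
by apply: eq_bigr => b _; rewrite ffunE mulrDl.
Qed.

Lemma gconvDr : right_distributive gconv +%R.
Proof.
move=> x y z; apply/ffunP=> a; rewrite !ffunE -big_split.
by apply: eq_bigr => b _; rewrite ffunE mulrDr.
Qed.

Lemma gbase1_neq0 : gbase 1%g != 0.
Proof. by apply/eqP => /ffunP/(_ 1%g); rewrite !ffunE eqxx. Qed.

HB.instance Definition _ := GRing.Zmodule_isNzRing.Build zgalg
  gconvA gconv1 gconvr1 gconvDl gconvDr gbase1_neq0.

Lemma gbaseM (a b : H) : gbase a * gbase b = gbase (a * b)%g.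
Proof.
apply/ffunP=> c; rewrite ffunE (bigD1 a) //= big1 => [|d /negPf nd].
  by rewrite !ffunE eqxx mul1r addr0 (can2_eq (mulKVg a) (mulKg a)).
by rewrite ffunE nd mul0r.
Qed.

End GroupAlgebra.

Section Spans.
Variables (T : eqType) (V : zmodType) (I : pred T) (f : T -> V).
Local Open Scope ring_scope.

(* Zspan is the sum of the subgroups Z (f i), i in I; together with Zfree this
   says that it is the direct sum of free rank-one modules Z (f i). *)
Definition Zspan (x : V) : Prop :=
  exists (s : seq T) (c : T -> int),
    all I s /\ x = \sum_(i <- s) f i *~ c i.

Definition Zfree : Prop :=
  forall (s : seq T) (c : T -> int), uniq s -> all I s ->
    \sum_(i <- s) f i *~ c i = 0 -> forall i, i \in s -> c i = 0.

End Spans.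

Definition nonunital_subring (R : nzRingType) (A : R -> Prop) : Prop :=
  [/\ A 0%R,
      forall x y, A x -> A y -> A (x - y)%R
    & forall x y, A x -> A y -> A (x * y)%R].

Section Rainbow.
Variables (A : Type) (C : eqType).

Fixpoint rainbow (w : seq (A * C)) : seq (seq A * C) :=
  if w is (a, g) :: w' then
    if rainbow w' is (u, h) :: r then
      if g == h then (a :: u, h) :: r else ([:: a], g) :: (u, h) :: r
    else [:: ([:: a], g)]
  else [::].

Definition colour (g : C) (u : seq A) : seq (A * C) := [seq (a, g) | a <- u].

Definition is_rainbow (w : seq (A * C)) (r : seq (seq A * C)) : Prop :=
  [/\ flatten [seq colour u.2 u.1 | u <- r] = w,
      all (fun u => 0 < size u.1) r
    & sorted (fun u v => u.2 != v.2) r].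

Lemma rainbowP (w : seq (A * C)) : is_rainbow w (rainbow w).
Proof.
elim: w => [|[a g] w [IHf IHn IHs]] //=.
case: (rainbow w) IHf IHn IHs => [|[u h] r] /= <- // /andP[un rn] rs.
case: eqP => [->|/eqP gh]; last by split=> //=; rewrite ?un ?rn ?gh.
by split=> //=; case: (r) rs.
Qed.

Lemma rainbow_uniq (w : seq (A * C)) r : is_rainbow w r -> r = rainbow w.
Proof.
move=> [<- {w}]; elim: r => [|[u h] r IHr] //= /andP[un rn] us.
have {}IHr := IHr rn (path_sorted us).
have {}us : if r is v :: _ then h != v.2 else true.
  by case: (r) us => //= v r' /andP[].
elim: u un => [|a [|b u] IHu] //= _.
  by rewrite -IHr; case: (r) us => [|[v k] r'] //= /negPf->.
by have /= <- := IHu isT; rewrite eqxx.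
Qed.

End Rainbow.

(* The word s(1) ... s(n), with values shifted from 'I_n to [1, n]. *)
Definition perm_word (n : nat) (s : 'S_n) : seq nat :=
  [seq (s i : nat).+1 | i <- enum 'I_n].

(* letter s i is s(i) for i in [1, n]; its value elsewhere is irrelevant. *)
Definition letter (n : nat) (s : 'S_n) (i : nat) : nat :=
  nth 0 (perm_word s) i.-1.

Definition is_std (w : seq nat) (s : 'S_(size w)) : bool :=
  [forall i : 'I_(size w), forall j : 'I_(size w),
    (i < j) ==> ((s j < s i) == (nth 0 w j < nth 0 w i))].

Definition std (w : seq nat) : 'S_(size w) :=
  odflt 1%g [pick s : 'S_(size w) | is_std s].

Section StdSpec.
Variable w : seq nat.
Let N := size w.
Let before (i j : 'I_N) : bool :=
  (nth 0 w i < nth 0 w j) || (nth 0 w i == nth 0 w j) && (i < j).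

Let before_irr i : before i i = false.
Proof. by rewrite /before !ltnn andbF. Qed.

Let before_trans : transitive before.
Proof.
rewrite /before => j i k /orP[ij|/andP[/eqP-> ij]] /orP[jk|/andP[/eqP jk jk']].
- by rewrite (ltn_trans ij jk).
- by rewrite -jk ij.
- by rewrite jk.
- by rewrite jk eqxx (ltn_trans ij jk') orbT.
Qed.

Let before_total i j : i != j -> before i j || before j i.
Proof.
rewrite /before -val_eqE /=; case: ltngtP => //= _; rewrite neq_ltn => /orP[]->;
  by rewrite ?orbT.
Qed.

Let rank (i : 'I_N) : nat := #|[pred j | before j i]|.

Let rank_lt i j : before i j -> rank i < rank j.
Proof.
move=> ij; apply/proper_card/properP; split.
  by apply/subsetP => k; rewrite !inE => /before_trans; apply.
by exists i; rewrite !inE ?before_irr.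
Qed.

Let rank_bound i : rank i < N.
Proof.
rewrite -[X in _ < X]card_ord; apply/proper_card/properP.
by split; [apply/subsetP | exists i; rewrite // inE before_irr].
Qed.

Let rank_ord i := Ordinal (rank_bound i).

Let rank_inj : injective rank_ord.
Proof.
move=> i j [eq_ij]; apply/eqP; case: (altP eqP) => // /before_total /orP[] /rank_lt;
  by rewrite eq_ij ltnn.
Qed.

Lemma std_exists : exists s : 'S_(size w), is_std s.
Proof.
exists (perm rank_inj); apply/forallP=> i; apply/forallP=> j; apply/implyP=> ij.
rewrite !permE /=; case: (ltnP (nth 0 w j)) => [ji|le_ij].
  by rewrite rank_lt // /before ji.
rewrite ltnNge ltnW // rank_lt // /before; move: le_ij.
by rewrite leq_eqVlt => /orP[->|->] //; rewrite ij orbT.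
Qed.

End StdSpec.

Lemma stdP (w : seq nat) : is_std (std w).
Proof.
rewrite /std; case: pickP => //= no_s; case: (std_exists w) => s.
by rewrite no_s.
Qed.

Lemma is_std_uniq (w : seq nat) (s t : 'S_(size w)) :
  is_std s -> is_std t -> s = t.
Proof.
move=> Hs Ht.
have ltst (i j : 'I_(size w)) : (s i < s j) = (t i < t j).
  have key (k l : 'I_(size w)) : k < l -> (s l < s k) = (t l < t k).
    move=> kl; have /forallP/(_ k)/forallP/(_ l)/implyP/(_ kl)/eqP-> := Hs.
    by have /forallP/(_ k)/forallP/(_ l)/implyP/(_ kl)/eqP-> := Ht.
  case: (ltngtP i j) => [ij|ji|/val_inj->]; last by rewrite !ltnn.
  - have sij : s i != s j by rewrite (inj_eq perm_inj) -val_eqE neq_ltn ij.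
    have tij : t i != t j by rewrite (inj_eq perm_inj) -val_eqE neq_ltn ij.
    by rewrite !ltn_neqAle sij tij /= leqNgt key // -leqNgt.
  - exact: key.
have rk (u : 'S_(size w)) i : #|[pred j | u j < u i]| = u i :> nat.
  rewrite -sum1_card (reindex_inj (@perm_inj _ u^-1)) /=.
  under eq_bigl => j do rewrite inE permKV.
  by rewrite -(big_ord_widen _ (fun=> 1)) ?sum1_card ?card_ord // ltnW.
apply/permP=> i; apply: val_inj; rewrite /= -(rk s) -(rk t).
by apply: eq_card => j; rewrite !inE ltst.
Qed.

(* The composition c_I of n attached to the set I, of which only the part in
   [1, n-1] is used; it is only meaningful for n > 0, the case needed here. *)
Definition comp_of (n : nat) (I : pred nat) : seq nat :=
  pairmap (fun i j => j - i) 0 (rcons [seq i <- iota 1 n.-1 | I i] n).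

Definition Des (n : nat) (s : 'S_n) : pred nat :=
  [pred i | (0 < i < n) && (letter s i.+1 < letter s i)].

Definition ipeak (n : nat) (s : 'S_n) : pred nat :=
  [pred i | [&& 0 < i < n, 1 < i, letter s i.-1 < letter s i
              & letter s i.+1 < letter s i]].

Definition Dcomp (n : nat) (s : 'S_n) : seq nat := comp_of n (Des s).
Definition Pcomp (n : nat) (s : 'S_n) : seq nat := comp_of n (ipeak s).

Section MantaciReutenauer.
Variables (n : nat) (G : finGroupType).
Local Open Scope ring_scope.

(* c_1^{g_1} ... c_r^{g_r} is encoded as [:: (c_1, g_1); ...; (c_r, g_r)]. *)
Definition is_Gcomp (c : seq (nat * G)) : bool :=
  all (fun p => 0 < p.1)%N c && (sumn (unzip1 c) == n).

Definition coloured_word (a : wreath n G) : seq (nat * G) :=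
  [seq ((wperm a i : nat).+1, wcol a i) | i <- enum 'I_n].

Definition DG (a : wreath n G) : seq (nat * G) :=
  flatten [seq colour u.2 (Dcomp (std u.1)) | u <- rainbow (coloured_word a)].

Definition PG (a : wreath n G) : seq (nat * G) :=
  flatten [seq colour u.2 (Pcomp (std u.1)) | u <- rainbow (coloured_word a)].

Definition PiG : pred (seq (nat * G)) :=
  [pred c | [exists a : wreath n G, PG a == c]].

Definition dG (c : seq (nat * G)) : zgalg (wreath n G) :=
  \sum_(a | DG a == c) gbase a.

Definition pG (c : seq (nat * G)) : zgalg (wreath n G) :=
  \sum_(a | PG a == c) gbase a.

Definition MR_algebra : zgalg (wreath n G) -> Prop := Zspan is_Gcomp dG.

Definition interior_peak_module : zgalg (wreath n G) -> Prop := Zspan PiG pG.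

End MantaciReutenauer.

(* Main.v *)
Require Import Defs.
From mathcomp Require Import all_boot all_order all_algebra all_fingroup.
From mathcomp Require Import zify.

Set Implicit Arguments.
Unset Strict Implicit.
Unset Printing Implicit Defensive.

(** An element of the group algebra lies in the span of the sums over the
    fibres of a map K exactly when its coefficients are constant on these
    fibres (span_fibre_sums). So the theorem says that constancy on the fibres
    of PG is stable under convolution. The inclusion in the Mantaci-Reutenauer
    algebra holds because DG determines PG.

    The fibres of PG are first put in local form. Replace each part of a
    coloured composition by a marked letter followed by unmarked ones, all of
    the colour of the part; applied to PG of a coloured word, this puts a mark
    at a position when it starts a rainbow block or follows an interior peak of
    its block (expand_runcomp). Hence PG a = PG b if and only if a and b have
    the same colour at each position and the same peaks on the graph that
    links neighbouring positions of equal colour (PG_eqP).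

    The key is that such a fibre is an orbit of elementary moves: exchange the
    values i and i+1 when their positions are not linked, and exchange the two
    least values whatever their positions. Such moves keep the peaks, because a
    peak exceeds two other values and so is neither of the two least
    (peak_swap). Conversely, two permutations with the same peaks are joined by
    moves (reach_peak): let v be the position of the greatest value in the
    target; that value can be brought to v by moves (reach_top), after which v
    is deleted from the graph and one concludes by induction.

    Finally, let a' = m a with m the exchange of i and i+1, an elementary move
    for a. The coefficient of a in x y is the sum of x b * y (b^-1 a) over b.
    If the exchange is a move for b, then (m b)^-1 a' = b^-1 a, with m b and b
    in the same fibre. If not, i and i+1 lie at linked positions p and q of b,
    so that b^-1 a' is b^-1 a with its values p and q exchanged, and
    this is a move for b^-1 a (PG_mul_swap). Hence exchanging b with m b in the
    first case, and keeping b in the second, matches the coefficients of a and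
    a' term by term (conv_swap). *)

(** * Permutations with the same peaks on a graph of maximal degree two *)

Section Moves.
Variable n : nat.
Implicit Types (s t : 'S_n) (e : rel 'I_n) (a b : 'I_n).

(** The elementary moves. The pair of least values is exempt from the condition
    on positions; this exemption is what merges descent classes into peak
    classes. *)
Definition free_swap e s (a b : 'I_n) : bool :=
  (b == a.+1 :> nat) && ((a == 0 :> nat) || ~~ e (s^-1 a)%g (s^-1 b)%g).

(** The bound k on the exchanged values makes it possible to freeze the positions
    of the large values in an induction. *)
Inductive reach e k : 'S_n -> 'S_n -> Prop :=
| reach_refl s : reach e k s s
| reach_step s t (a b : 'I_n) :
    b < k -> free_swap e s a b -> reach e k (s * tperm a b)%g t -> reach e k s t.

(** On a graph of maximal degree 2, a local maximum is an interior peak when it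
    has two neighbours. *)
Definition peak e s (v : 'I_n) : bool :=
  (1 < #|e v|) && [forall u, e v u ==> (s u < s v)].

Lemma reach_trans e k s t u : reach e k s t -> reach e k t u -> reach e k s u.
Proof.
by elim=> // {}s {}t a b bk ab _ IH /IH; apply: reach_step.
Qed.

Lemma swap_val (a b x : 'I_n) : b = a.+1 :> nat ->
  tperm a b x = (if x == a :> nat then a.+1 else if x == a.+1 :> nat then a else x) :> nat.
Proof.
move=> ab; case: tpermP => [->|->|/eqP xa /eqP xb]; first by rewrite eqxx ab.
  by rewrite ab eqxx; case: eqP => //; lia.
by move: xa xb; rewrite -!val_eqE /= ab => /negPf-> /negPf->.
Qed.

Lemma swap_lt s a b u v : b = a.+1 :> nat -> s u < s v ->
  ~~ ((s u == a) && (s v == b)) -> (s * tperm a b)%g u < (s * tperm a b)%g v.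
Proof.
move=> ab; rewrite !permM !(swap_val _ ab) -!val_eqE /= ab.
by do !case: ifP; lia.
Qed.

Lemma free_swap_sym e s a b : symmetric e ->
  free_swap e s a b -> free_swap e (s * tperm a b)%g a b.
Proof.
by move=> es; rewrite /free_swap !invMg !permM tpermV tpermL tpermR es.
Qed.

(** The exchange reverses no comparison other than that of the two exchanged
    values. If their positions are linked, they are 0 and 1, and a peak has
    value at least 2. *)
Lemma peak_swap e s a b : symmetric e -> free_swap e s a b ->
  peak e (s * tperm a b)%g =1 peak e s.
Proof.
move=> es.
have imp t : free_swap e t a b -> forall v, peak e t v -> peak e (t * tperm a b)%g v.
  move=> /andP[/eqP ab fr] v /andP[dv /forallP mv]; rewrite /peak dv /=.
  have {}mv u : e v u -> t u < t v by move/implyP: (mv u).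
  apply/forallP=> u; apply/implyP=> evu.
  apply: swap_lt => //; first exact: mv.
  apply/andP=> -[/eqP ua /eqP vb]; move: fr.
  rewrite -ua -vb !permK (es u) evu orbF => /eqP u0.
  have /card_gt1P[x [y [evx evy]]] := dv.
  have := mv _ evx; have := mv _ evy; rewrite vb ab -ua u0 !ltnS !leqn0.
  move=> /eqP y0 /eqP x0 /eqP[]; apply: (@perm_inj _ t); apply: val_inj.
  by rewrite /= x0 y0.
move=> ab v; apply/idP/idP => [|/(imp _ ab)//].
by move/(imp _ (free_swap_sym es ab)); rewrite -mulgA tperm2 mulg1.
Qed.

Lemma peak_reach e k s t : symmetric e -> reach e k s t -> peak e t =1 peak e s.
Proof.
by move=> es; elim=> // {}s {}t a b _ ab _ IH v; rewrite IH peak_swap.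
Qed.

Lemma reach_fix e k s t v : reach e k s t ->
  (k <= s v) || (k <= t v) -> t v = s v.
Proof.
elim=> // {}s {}t a b bk /andP[/eqP ab _] _.
rewrite permM => IH kst.
have tE := swap_val (s v) ab.
have: (k <= tperm a b (s v)) || (k <= t v).
  by case/orP: kst => [ks|->]; [move: tE; do !case: ifP; lia|rewrite orbT].
move/IH => tv; rewrite tv; apply: val_inj; rewrite /= tE.
by move: kst tE; rewrite tv; move: (tperm _ _ _) => z; do !case: ifP; lia.
Qed.

(** When v is a local maximum, the position of the next greater value is not
    linked to v, so the value at v can grow step by step. *)
Lemma reach_raise e k s v : k < n -> s v <= k ->
  (forall u, e v u -> s u < s v) -> exists2 t, reach e k.+1 s t & t v = k :> nat.
Proof.
move=> kn; move dE: (k - s v) => d; elim: d s dE => [|d IH] s dE svk mv.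
  by exists s; [exact: reach_refl | lia].
have sv1n : (s v).+1 < n by lia.
pose b := Ordinal sv1n.
have swE u := swap_val (s u) (erefl : b = (s v).+1 :> nat).
have [|||t rt tv] := IH (s * tperm (s v) b)%g.
- by rewrite permM tpermL /=; lia.
- by rewrite permM tpermL /=; lia.
- move=> u /mv uv; rewrite !permM tpermL /= swE.
  by do !case: ifP; lia.
exists t => //; apply: (@reach_step _ _ _ _ (s v) b) rt; first by rewrite /=; lia.
rewrite /free_swap eqxx /= permK; apply/orP; right; apply/negP => /mv.
by rewrite permKV /=; lia.
Qed.

(** Dual to the previous lemma, except that neighbours may also carry values
    below the target l, which these moves do not touch. *)
Lemma reach_lower e k l s v : s v <= k -> l <= s v -> symmetric e ->
  (forall u, e v u -> (s u < l) || (s v < s u)) ->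
  exists t, [/\ reach e k.+1 s t, t v = l :> nat & forall u, s u < l -> t u = s u].
Proof.
move=> svk lsv es.
move dE: (s v - l) => d; elim: d s dE svk lsv => [|d IH] s dE svk lsv mv.
  by exists s; split=> //; [exact: reach_refl | lia].
have sv1n : (s v).-1 < n by have := ltn_ord (s v); lia.
pose a := Ordinal sv1n.
have ab : s v = a.+1 :> nat by rewrite /=; lia.
have swE u := swap_val (s u) ab.
have [||||t [rt tv tl]] := IH (s * tperm a (s v))%g.
- by rewrite permM tpermR /=; lia.
- by rewrite permM tpermR /=; lia.
- by rewrite permM tpermR /=; lia.
- move=> u /mv uv; rewrite !permM tpermR /= swE /=.
  by do !case: ifP; lia.
exists t; split => // [|u ul].
  apply: (@reach_step _ _ _ _ a (s v)) rt; first by rewrite /=; lia.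
  rewrite /free_swap ab eqxx /= permK; apply/orP; right; apply/negP.
  by rewrite es => /mv; rewrite permKV /=; lia.
have su : tperm a (s v) (s u) = s u.
  by apply: val_inj; rewrite /= swE /=; do !case: ifP; lia.
by rewrite tl permM su.
Qed.

(** If v is not already a local maximum of s, then, v being a local maximum
    of t and the peaks being the same, v has a single neighbour f, and s f > s v. Lower v to
    0, then f to 1: the other neighbour of f, if any, stays above f, for
    otherwise f would be a peak, which it is not for t. Now exchange 0 and 1:
    v becomes a local maximum and can be raised. *)
Lemma reach_top e k s t v : symmetric e -> irreflexive e ->
  (forall u, #|e u| <= 2) -> k < n ->
  (forall u w, e u w -> s u <= k) -> (forall u w, e u w -> t u <= k) ->
  s v <= k -> t v = k :> nat ->
  peak e s =1 peak e t -> exists2 s1, reach e k.+1 s s1 & s1 v = k :> nat.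
Proof.
move=> es ei deg kn esk etk svk tvk pst.
have tltv u w : e u w -> u != v -> t u < t v.
  move=> /etk; rewrite tvk leq_eqVlt => /orP[|//] /eqP tu /eqP[].
  by apply: (@perm_inj _ t); apply: val_inj; rewrite /= tu tvk.
have nev u : e v u -> u != v by apply: contraTneq => ->; rewrite ei.
have [/forallP mv|] := boolP [forall u, e v u ==> (s u < s v)].
  by apply: reach_raise => // u; apply/implyP/mv.
case/forallPn=> f; rewrite negb_imply -leqNgt => /andP[evf svf].
have efv : e f v by rewrite es.
have fv := nev f evf.
have lev : #|e v| <= 1.
  rewrite leqNgt; apply/negP => gtv.
  have: peak e t v.
    rewrite /peak gtv /=; apply/forallP=> u; apply/implyP=> evu.
    by apply: (tltv u v); rewrite ?nev // es.
  by rewrite -pst => /andP[_ /forallP/(_ f)]; rewrite evf ltnNge svf.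
have uniq_f u : e v u -> u = f.
  by move=> evu; apply: (card_le1_eqP lev).
have npf : ~~ peak e t f.
  apply/negP => /andP[_ /forallP/(_ v)]; rewrite efv /=.
  by have := tltv f v efv fv; lia.
have svf' : s v < s f.
  by rewrite ltn_neqAle svf (inj_eq val_inj) (inj_eq perm_inj) eq_sym fv.
have [|s1 [r1 s1v _]] := @reach_lower e k 0 s v svk (leq0n _) es.
  by move=> u /uniq_f->.
have p1 : ~~ peak e s1 f by rewrite (peak_reach es r1) pst.
have s1f : 0 < s1 f.
  rewrite lt0n -s1v; apply: contraNneq fv => /val_inj /perm_inj-> //.
have s1fk : s1 f <= k.
  rewrite leqNgt; apply/negP => kf; move: (kf).
  by rewrite (reach_fix r1) ?kf ?orbT // ltnNge (esk _ _ efv).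
have [|s2 [r2 s2f s2l]] := @reach_lower e k 1 s1 f s1fk s1f es.
  move=> w efw; have [->|wv] := eqVneq w v; first by rewrite s1v.
  rewrite orbC ltnNge; apply/orP; left; apply: contra p1 => wf.
  have wf' : w != f by apply: contraTneq efw => ->; rewrite ei.
  have efE : e f =i pred2 v w.
    apply/fsym/subset_cardP; last first.
      by apply/subsetP=> u; rewrite !inE => /orP[]/eqP->.
    apply/eqP; rewrite eqn_leq card2 eq_sym wv deg andbT.
    apply/card_gt1P; exists v, w; split=> //.
    by rewrite eq_sym.
  rewrite /peak (eq_card efE) card2 eq_sym wv /=.
  apply/forallP=> u; apply/implyP=> efu.
  have: u \in pred2 v w by rewrite -efE.
  case/orP=> /eqP->; first by rewrite s1v.
  by rewrite ltn_neqAle wf (inj_eq val_inj) (inj_eq perm_inj) wf'.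
have s2v : s2 v = 0 :> nat by rewrite s2l s1v.
have fsw : free_swap e s2 (s2 v) (s2 f) by rewrite /free_swap s2v s2f eqxx.
case: (posnP k) => [k0|k_gt0].
  by exists s1; [exact: reach_trans r1 (reach_refl _ _ _)|rewrite s1v k0].
have [|u /uniq_f->|s3 r3 s3v] :=
  @reach_raise e k (s2 * tperm (s2 v) (s2 f))%g v kn.
- by rewrite permM tpermL s2f.
- by rewrite !permM tpermL tpermR s2v s2f.
exists s3 => //; apply: reach_trans r1 _; apply: reach_trans r2 _.
by apply: reach_step fsw r3; rewrite s2f.
Qed.

(** A position that holds the value k is not moved by exchanges of smaller
    values, so links at that position impose no condition on them. *)
Lemma reach_sub e e' k s t v : reach e' k s t -> s v = k :> nat ->
  (forall u w, u != v -> w != v -> e u w -> e' u w) -> reach e k.+1 s t.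
Proof.
move=> r; elim: r v => [|{}s {}t a b bk ab _ IH] v svk sub.
  by move=> *; exact: reach_refl.
have /andP[/eqP ab1 fr] := ab.
apply: (@reach_step _ _ _ _ a b); first exact: ltnW.
  rewrite /free_swap ab1 eqxx /=; case/orP: fr => [->//|fr].
  apply/orP; right; apply: contra fr; apply: sub.
    by apply/eqP=> va; move: svk; rewrite -va permKV; lia.
  by apply/eqP=> va; move: svk; rewrite -va permKV; lia.
apply: (IH v) => //; rewrite permM swap_val //.
by do !case: ifP; lia.
Qed.

(** Induction on k: bring the value k to its position v in t, then cut the links
    at v. The peaks of the smaller graph are those peaks of the larger one that
    keep two neighbours, hence still agree. *)
Lemma reach_peak_lt e k s t : k <= n -> symmetric e -> irreflexive e ->
  (forall u, #|e u| <= 2) -> (forall u w, e u w -> s u < k) ->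
  (forall u, k <= s u -> t u = s u) -> peak e s =1 peak e t -> reach e k s t.
Proof.
elim: k e s t => [|k IH] e s t kn es ei deg esk st pst.
  have -> : t = s by apply/permP => u; apply: st.
  exact: reach_refl.
pose v := (t^-1 (Ordinal kn))%g.
have tvk : t v = k :> nat by rewrite permKV.
have stE u : k < t u -> t u = s u.
  move=> kt; have := st (s^-1 (t u))%g; rewrite permKV => /(_ kt) /perm_inj su.
  by rewrite -{2}su permKV.
have svk : s v <= k.
  by rewrite leqNgt; apply/negP => ks; have := st _ ks; move/(congr1 val) => /=; lia.
have etk u w : e u w -> t u <= k.
  by move=> /esk; rewrite leqNgt => sk; apply/negP => tk; move: sk; rewrite -stE //; lia.
have [||s1 r1 s1v] := reach_top es ei deg kn _ _ svk tvk pst; [exact: esk|exact: etk|].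
apply: (reach_trans r1).
pose e' : rel 'I_n := fun u w => [&& u != v, w != v & e u w].
apply: (@reach_sub _ e' _ _ _ v) => //; last by move=> u w uv wv euw; apply/and3P.
have e'e u : {subset e' u <= e u} by move=> w /and3P[].
have e's : symmetric e' by move=> u w; rewrite /e' es andbCA.
apply: IH.
- exact: ltnW.
- exact: e's.
- by move=> u; rewrite /e' ei !andbF.
- by move=> u; apply: leq_trans (deg u); apply: subset_leq_card; apply/subsetP/e'e.
- move=> u w /and3P[uv _ euw]; rewrite ltn_neqAle -s1v.
  rewrite (inj_eq val_inj) (inj_eq perm_inj) uv s1v leqNgt; apply/negP=> ku.
  by move: (ku); rewrite (reach_fix r1) ?ku ?orbT // ltnNge -ltnS (esk _ _ euw).
- move=> u; rewrite leq_eqVlt => /orP[/eqP ku|ku].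
    have -> : u = v by apply: (@perm_inj _ s1); apply: val_inj; rewrite /= -ku s1v.
    by apply: val_inj; rewrite /= tvk s1v.
  have s1u : s1 u = s u by apply: (reach_fix r1); rewrite ku orbT.
  by rewrite s1u st // -s1u.
have pe' r u : peak e' r u = (1 < #|e' u|) && peak e r u.
  rewrite /peak; case: ltnP => //= du.
  have eu : e' u =i e u.
    apply/subset_cardP; last by apply/subsetP/e'e.
    apply/eqP; rewrite eqn_leq (leq_trans (deg u) du) andbT.
    by apply: subset_leq_card; apply/subsetP/e'e.
  rewrite -(eq_card eu) du /=; apply: eq_forallb => w.
  by have := eu w; rewrite /in_mem /= => ->.
by move=> u; rewrite !pe' (peak_reach es r1) pst.
Qed.

Lemma reach_peak e s t : symmetric e -> irreflexive e ->
  (forall u, #|e u| <= 2) -> peak e s =1 peak e t -> reach e n s t.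
Proof.
move=> es ei deg; apply: reach_peak_lt => // u; last by rewrite leqNgt ltn_ord.
Qed.
End Moves.

(** * Marked words of coloured compositions *)

Section Expand.
Variable G : finGroupType.
Implicit Types (c : seq (nat * G)) (w : seq (nat * G)) (g : G).

(** A part k of colour g becomes k letters of colour g, the first of them
    marked. This turns the global data of a coloured composition into data
    attached to positions. *)
Definition expand c : seq (bool * G) :=
  flatten [seq (true, p.2) :: nseq p.1.-1 (false, p.2) | p <- c].

(** Reading from the right, the first component counts the unmarked letters
    whose mark is still to come. *)
Definition unexpand (m : seq (bool * G)) : nat * seq (nat * G) :=
  foldr (fun x acc => if x.1 then (0, (acc.1.+1, x.2) :: acc.2) else (acc.1.+1, acc.2))
    (0, [::]) m.

Lemma expandK c : all (fun p => 0 < p.1) c -> unexpand (expand c) = (0, c).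
Proof.
elim: c => [|[k g] c IH] //= /andP[k0 /IH {}IH].
rewrite /expand /= /unexpand foldr_cat -/(unexpand _) IH.
have nsE : forall m, foldr (fun x acc => if x.1 then (0, (acc.1.+1, x.2) :: acc.2)
     else (acc.1.+1, acc.2)) (0, c) (nseq m (false, g)) = (m, c).
  by elim=> //= m ->.
by rewrite nsE /= prednK.
Qed.

Lemma size_expand c : all (fun p => 0 < p.1) c ->
  size (expand c) = sumn (unzip1 c).
Proof.
elim: c => [|[k g] c IH] //= /andP[k0 /IH {}IH].
by rewrite size_cat size_nseq -[size _]/(size (expand c)) IH -addSn prednK.
Qed.

Lemma expand_cat c1 c2 : expand (c1 ++ c2) = expand c1 ++ expand c2.
Proof. by rewrite /expand map_cat flatten_cat. Qed.

Lemma comp_of_pos m I : 0 < m -> all (fun k => 0 < k) (comp_of m I).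
Proof.
case: m => // m _; rewrite /comp_of /=.
(* b is where the current part starts, a the last integer scanned *)
suff gen a b l : b <= a ->
    all (fun k => 0 < k)
      (pairmap (fun i j => j - i) b (rcons [seq i <- iota a.+1 l | I i] (a + l.+1))).
  by rewrite -[m.+1]add0n; apply: gen.
elim: l a b => [|l IH] a b ba /=; first by rewrite andbT; lia.
case: ifP => Ia /=; rewrite -addSnnS.
  by rewrite IH // andbT; lia.
by apply: IH; lia.
Qed.

(** The marks sit at 0 and at the elements of I, since the block that follows
    i in I starts at the position i counted from 0. *)
Lemma expand_comp_of g m I : 0 < m ->
  expand (colour g (comp_of m I)) = [seq ((j == 0) || I j, g) | j <- iota 0 m].
Proof.
case: m => // m _; rewrite /comp_of /=.
(* b is where the current part starts, a the last integer scanned, so that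
   a - b unmarked letters precede the next candidate *)
suff gen a b l : b <= a ->
    expand (colour g
      (pairmap (fun i j => j - i) b (rcons [seq i <- iota a.+1 l | I i] (a + l.+1))))
    = (true, g) :: nseq (a - b) (false, g) ++ [seq (I j, g) | j <- iota a.+1 l].
  rewrite -[X in rcons _ X]add0n gen //=; congr (_ :: _).
  apply/eq_in_map => j; rewrite mem_iota => /andP[j0 _].
  by rewrite (gtn_eqF j0).
elim: l a b => [|l IH] a b ba /=.
  by rewrite /expand /= !cats0 addn1 subSn.
case: ifP => Ia /=; rewrite -addSnnS; last first.
  rewrite IH; last lia.
  by rewrite subSn // -addn1 nseqD -catA.
by rewrite /expand /= -/(expand _) IH // subnn subSn.
Qed.

Definition letter_at w j := nth 0 (unzip1 w) j.
Definition colour_at w j : G := nth 1%g (unzip2 w) j.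

Definition runcomp (I : seq nat -> pred nat) w :=
  flatten [seq colour u.2 (comp_of (size u.1) (I u.1)) | u <- rainbow w].

Lemma runcomp_pos I w : all (fun p => 0 < p.1) (runcomp I w).
Proof.
have [_ + _] := rainbowP w; rewrite /runcomp.
elim: (rainbow w) => //= -[u g] r IH /= /andP[u0 r0].
by rewrite all_cat IH // andbT all_map; apply: comp_of_pos.
Qed.

Lemma letter_at_cat g u w j :
  letter_at (colour g u ++ w) j = if j < size u then nth 0 u j else letter_at w (j - size u).
Proof.
rewrite /letter_at /unzip1 map_cat nth_cat size_map size_map.
by rewrite -map_comp map_id.
Qed.

Lemma colour_at_cat g u w j :
  colour_at (colour g u ++ w) j = if j < size u then g else colour_at w (j - size u).
Proof.
rewrite /colour_at /unzip2 map_cat nth_cat size_map size_map -map_comp.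
by case: ifP => // ju; rewrite (nth_map 0).
Qed.

(** The marking rule depends only on the rainbow block of a position: within the
    first block it is given by I, and deleting that block changes nothing in
    the rest of the word. *)
Definition local_mark (I : seq nat -> pred nat) (mark : seq (nat * G) -> pred nat) :=
  (forall g u w j, j < size u -> mark (colour g u ++ w) j = (j == 0) || I u j) /\
  (forall g u w j, 0 < size u -> j < size w -> colour_at w 0 != g ->
     mark (colour g u ++ w) (size u + j) = mark w j).

Lemma expand_runcomp I mark w : local_mark I mark ->
  expand (runcomp I w) = [seq (mark w j, colour_at w j) | j <- iota 0 (size w)].
Proof.
move=> [mark1 mark2]; have [wE + +] := rainbowP w; rewrite -{4 5 6}wE /runcomp.
elim: (rainbow w) => [|[u g] r IH] //= /andP[u0 r0] sr.
rewrite expand_cat expand_comp_of // IH ?(path_sorted sr) //.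
set w' := flatten _; rewrite size_cat size_map iotaD map_cat; congr (_ ++ _).
  apply/eq_in_map => j; rewrite mem_iota => /andP[_ ju].
  by rewrite mark1 // colour_at_cat ju.
have w'g : 0 < size w' -> colour_at w' 0 != g.
  rewrite /w'; case: (r) sr r0 => [|[[|x v] h] r'] //= /andP[gh _] _ _.
  by rewrite eq_sym.
rewrite add0n -[size u]addn0 iotaDl -map_comp.
apply/eq_in_map => j; rewrite mem_iota => /andP[_ jw] /=.
rewrite mark2 //; last by apply: w'g; apply: leq_ltn_trans jw.
by rewrite colour_at_cat ltnNge leq_addr /= addKn.
Qed.

(** Positions are counted from 0, so that a mark at a position j that does not
    start a block says that the j-th letter, counted from 1, is a descent; for
    pmark, that it is a peak. *)
Definition dmark w j :=
  [|| j == 0, colour_at w j.-1 != colour_at w j | letter_at w j < letter_at w j.-1].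

Definition pmark w j :=
  [|| j == 0, colour_at w j.-1 != colour_at w j |
      [&& 1 < j, colour_at w j.-2 == colour_at w j.-1, letter_at w j.-2 <= letter_at w j.-1
        & letter_at w j < letter_at w j.-1]].

Lemma letter_std u j (ju : j < size u) : letter (std u) j.+1 = (std u (Ordinal ju)).+1.
Proof.
rewrite /letter /perm_word /= (nth_map (Ordinal ju)) ?size_enum_ord //.
by congr (nat_of_ord _).+1; congr (std u _); apply: val_inj; rewrite /= nth_enum_ord.
Qed.

Lemma std_desc u j : j.+1 < size u ->
  (letter (std u) j.+2 < letter (std u) j.+1) = (nth 0 u j.+1 < nth 0 u j).
Proof.
move=> ju; rewrite (letter_std ju) (letter_std (ltnW ju)) ltnS.
by have /forallP/(_ (Ordinal (ltnW ju)))/forallP/(_ (Ordinal ju))/implyP/(_ (ltnSn _))/eqP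
   := stdP u.
Qed.

Lemma std_asc u j : j.+1 < size u ->
  (letter (std u) j.+1 < letter (std u) j.+2) = (nth 0 u j <= nth 0 u j.+1).
Proof.
move=> ju; rewrite [RHS]leqNgt -std_desc // -leqNgt [RHS]leq_eqVlt.
rewrite (letter_std ju) (letter_std (ltnW ju)) eqSS (inj_eq val_inj).
by rewrite (inj_eq perm_inj) -val_eqE /= ltn_eqF.
Qed.

Lemma dmark_local : local_mark (fun u => Des (std u)) dmark.
Proof.
split=> [g u w [|j] ju | g u w [|j] u0 jw wg] //.
- rewrite /dmark /Des /= !colour_at_cat !letter_at_cat ju ltnW // eqxx /=.
  by rewrite std_desc.
- rewrite addn0 /dmark !colour_at_cat ltnn subnn prednK // leqnn /= (eq_sym g) wg.
  by rewrite orbT.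
have geE i : (size u + i < size u) = false by rewrite ltnNge leq_addr.
have predE i : (size u + i.+1).-1 = size u + i by rewrite addnS.
by rewrite /dmark predE !colour_at_cat !letter_at_cat !geE !addKn addn_eq0 andbF.
Qed.

Lemma pmark_local : local_mark (fun u => ipeak (std u)) pmark.
Proof.
split=> [g u w [|j] ju | g u w [|j] u0 jw wg] //.
- rewrite /pmark /ipeak /= !colour_at_cat !letter_at_cat ju (ltnW ju) eqxx /=.
  case: j ju => [|j] ju //=; have ju1 := ltnW ju.
  by rewrite (ltnW ju1) eqxx std_desc // std_asc.
- rewrite addn0 /pmark !colour_at_cat ltnn subnn prednK // leqnn /= (eq_sym g) wg.
  by rewrite orbT.
have geE i : (size u + i < size u) = false by rewrite ltnNge leq_addr.
have predE i : (size u + i.+1).-1 = size u + i by rewrite addnS.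
rewrite /pmark predE !colour_at_cat !letter_at_cat !geE !addKn addn_eq0 andbF /=.
case: j jw => [|j] jw; last by rewrite predE geE addKn (_ : 1 < _ + _) // !addnS.
by rewrite addn0 prednK // leqnn (eq_sym g) (negPf wg) /= andbF.
Qed.
End Expand.

(** * Sums over the fibres of a map in the group algebra *)

Section Fibres.
Import GRing.Theory.
Local Open Scope ring_scope.
Variables (H : finGroupType) (T : eqType) (K : H -> T).
Implicit Type x : zgalg H.

Definition fibre_sum (c : T) : zgalg H := \sum_(a | K a == c) gbase a.

Lemma zgalg_sumE (J : Type) (r : seq J) (P : pred J) (F : J -> zgalg H) a :
  (\sum_(i <- r | P i) F i) a = \sum_(i <- r | P i) F i a.
Proof.
by elim/big_rec2: _ => [|i y z _ <-]; rewrite ffunE.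
Qed.

Lemma fibre_sumE c a : fibre_sum c a = (K a == c)%:R.
Proof.
rewrite zgalg_sumE big_mkcond (bigD1 a) //= big1 => [|b ba].
  by rewrite addr0 ffunE eqxx; case: (_ == _).
by rewrite ffunE (eq_sym a) (negPf ba) if_same.
Qed.

Lemma fibre_combE (r : seq T) (c : T -> int) a :
  (\sum_(i <- r) fibre_sum i *~ c i) a = \sum_(i <- r | K a == i) c i.
Proof.
rewrite zgalg_sumE [RHS]big_mkcond; apply: eq_bigr => i _.
rewrite ffunMzE fibre_sumE; case: (_ == _); last by rewrite mul0rz.
by rewrite mulrzz mul1r.
Qed.

Lemma fibre_combE_uniq (r : seq T) (c : T -> int) a : uniq r ->
  (\sum_(i <- r) fibre_sum i *~ c i) a = if K a \in r then c (K a) else 0.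
Proof.
move=> ur; rewrite fibre_combE; under eq_bigl => i do rewrite eq_sym.
case: ifP => [ar|/negbT ar].
  by rewrite -big_filter filter_pred1_uniq // big_seq1.
rewrite big1_seq // => i /andP[/eqP->] ai.
by rewrite ai in ar.
Qed.

Lemma span_fibre_sums (I : pred T) x : (forall a, I (K a)) ->
  Zspan I fibre_sum x <-> (forall a b, K a = K b -> x a = x b).
Proof.
move=> IK; split=> [[r [c [_ ->]]] a b Kab|xK]; first by rewrite !fibre_combE Kab.
exists (undup [seq K a | a : H]), (fun i => if [pick a | K a == i] is Some a then x a else 0).
split; first by apply/allP=> i; rewrite mem_undup => /imageP[a _ ->]; exact: IK.
apply/ffunP=> a; rewrite fibre_combE_uniq ?undup_uniq // mem_undup.
have -> : K a \in [seq K b | b : H] by apply/imageP; exists a.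
case: pickP => [b /eqP Kb|/(_ a)]; last by rewrite eqxx.
exact: xK.
Qed.

Lemma free_fibre_sums (I : pred T) : (forall c, I c -> exists a, K a = c) ->
  Zfree I fibre_sum.
Proof.
move=> IK r c ur /allP rI E i ir; have [a Ka] := IK i (rI i ir).
by have /ffunP/(_ a) := E; rewrite fibre_combE_uniq // Ka ir ffunE.
Qed.
End Fibres.

(** * Peak classes as peaks on the graph of monochromatic links *)

Section Classes.
Variables (n : nat) (G : finGroupType).
Implicit Types (a b : wreath n G) (g : {ffun 'I_n -> G}) (s : 'S_n).

Lemma size_coloured a : size (coloured_word a) = n.
Proof. by rewrite size_map size_enum_ord. Qed.

Lemma letter_at_coloured a (i : 'I_n) : letter_at (coloured_word a) i = (wperm a i).+1.
Proof.
rewrite /letter_at /unzip1 -map_comp (nth_map i) ?size_enum_ord //=.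
by rewrite nth_ord_enum.
Qed.

Lemma colour_at_coloured a (i : 'I_n) : colour_at (coloured_word a) i = wcol a i.
Proof.
rewrite /colour_at /unzip2 -map_comp (nth_map i) ?size_enum_ord //=.
by rewrite nth_ord_enum.
Qed.

Lemma DG_pos a : all (fun p => 0 < p.1) (DG a).
Proof. exact: (runcomp_pos (fun u => Des (std u))). Qed.

Lemma PG_pos a : all (fun p => 0 < p.1) (PG a).
Proof. exact: (runcomp_pos (fun u => ipeak (std u))). Qed.

Lemma expand_DG a : let w := coloured_word a in
  expand (DG a) = [seq (dmark w j, colour_at w j) | j <- iota 0 n].
Proof.
by move=> w; rewrite -[X in iota _ X](size_coloured a) -(expand_runcomp _ (@dmark_local G)).
Qed.

Lemma expand_PG a : let w := coloured_word a in
  expand (PG a) = [seq (pmark w j, colour_at w j) | j <- iota 0 n].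
Proof.
by move=> w; rewrite -[X in iota _ X](size_coloured a) -(expand_runcomp _ (@pmark_local G)).
Qed.

Lemma DG_Gcomp a : is_Gcomp n (DG a).
Proof.
by rewrite /is_Gcomp DG_pos -size_expand ?DG_pos // expand_DG size_map size_iota eqxx.
Qed.

(** For peaks and descents alike, a class is the datum of the colours and of the
    marks. *)
Lemma marks_eq (D : wreath n G -> seq (nat * G)) (mark : seq (nat * G) -> pred nat) a b :
  (forall a, all (fun p => 0 < p.1) (D a)) ->
  (forall a, expand (D a) =
     [seq (mark (coloured_word a) j, colour_at (coloured_word a) j) | j <- iota 0 n]) ->
  D a = D b <->
  wcol a = wcol b /\ forall j, j < n -> mark (coloured_word a) j = mark (coloured_word b) j.
Proof.
move=> Dpos DE; split=> [Dab|[cab mab]].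
  have jE j : j < n -> (mark (coloured_word a) j, colour_at (coloured_word a) j) =
                       (mark (coloured_word b) j, colour_at (coloured_word b) j).
    move: (DE b); rewrite -Dab DE => /eq_in_map E jn.
    by apply: E; rewrite mem_iota.
  split=> [|j /jE [] //]; apply/ffunP => i.
  by rewrite -!colour_at_coloured; case: (jE i (ltn_ord i)).
suff E : expand (D a) = expand (D b).
  by have [] := (expandK (Dpos a), expandK (Dpos b)); rewrite E => -> [].
rewrite !DE; apply/eq_in_map => j; rewrite mem_iota => /andP[_ jn].
by rewrite mab // -[j]/(val (Ordinal jn)) !colour_at_coloured cab.
Qed.

Definition link g : rel 'I_n :=
  fun i j => ((i.+1 == j) || (j.+1 == i)) && (g i == g j).

Lemma link_sym g : symmetric (link g).
Proof. by move=> i j; rewrite /link orbC (eq_sym (g i)). Qed.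

Lemma link_irr g : irreflexive (link g).
Proof. by move=> i; rewrite /link orbb gtn_eqF. Qed.

Lemma link_deg g i : #|link g i| <= 2.
Proof.
rewrite leqNgt; apply/negP => /card_gt2P[x [y [z [[ix iy iz] [xy yz zx]]]]].
move: xy yz zx ix iy iz; rewrite -!val_eqE /in_mem /= /link.
by move=> ? ? ? /andP[? _] /andP[? _] /andP[? _]; lia.
Qed.

Lemma peakP g s (v : 'I_n) :
  reflect (exists u w : 'I_n, [/\ u.+1 = v, w = v.+1 :> nat, g u = g v, g w = g v
                               & s u < s v /\ s w < s v])
    (peak (link g) s v).
Proof.
apply: (iffP idP) => [/andP[/card_gt1P[x [y [vx vy xy]]] /forallP mv]|].
  have {mv} mv u : link g v u -> s u < s v by apply/implyP.
  have key (u w : 'I_n) : u < w -> link g v u -> link g v w -> exists u w : 'I_n,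
     [/\ u.+1 = v, w = v.+1 :> nat, g u = g v, g w = g v & s u < s v /\ s w < s v].
    move=> uw vu vw; have su := mv _ vu; have sw := mv _ vw.
    move: vu vw => /andP[vu /eqP gu] /andP[vw /eqP gw].
    by exists u, w; split=> //; lia.
  have: x != y :> nat by [].
  by rewrite neq_ltn => /orP[xy'|xy']; [apply: (key x y)|apply: (key y x)].
move=> [u [w [uv wv gu gw [su sw]]]]; apply/andP; split.
  apply/card_gt1P; exists u, w; rewrite /in_mem /= /link uv wv gu gw !eqxx orbT.
  by split=> //; rewrite -val_eqE /=; lia.
apply/forallP=> x; apply/implyP=> /andP[vx _].
case/orP: vx => /eqP vx.
  by have -> : x = w by apply: val_inj; rewrite /= wv.
by have -> : x = u by apply: val_inj; apply/eqP; rewrite /= -eqSS uv vx.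
Qed.

(** When the colours agree at v and v + 1, the mark at v + 1 says that v is a
    peak; when they differ, v has at most one neighbour and is no peak. *)
Lemma pmark_peak a (v w : 'I_n) : w = v.+1 :> nat ->
  pmark (coloured_word a) w = (wcol a v != wcol a w) || peak (link (wcol a)) (wperm a) v.
Proof.
move=> wv; rewrite /pmark colour_at_coloured wv /= colour_at_coloured.
case: eqVneq => //= gvw.
apply/idP/peakP.
  case: v wv gvw => -[|v] // vn /= wv gvw.
  have un : v < n := ltnW vn.
  rewrite -wv /= letter_at_coloured -[v]/(val (Ordinal un)) -[v.+1]/(val (Ordinal vn)).
  rewrite !letter_at_coloured !colour_at_coloured => /and3P[/eqP gu su sw].
  exists (Ordinal un), w; split=> //; split=> //.
  rewrite ltn_neqAle -ltnS su andbT (inj_eq val_inj) (inj_eq perm_inj) -val_eqE /=.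
  by rewrite ltn_eqF.
move=> [u [w' [uv w'v gu gw [su sw]]]].
rewrite -w'v !letter_at_coloured -uv /= colour_at_coloured letter_at_coloured gu.
by rewrite eqxx !ltnS sw (ltnW su) w'v -uv.
Qed.

Lemma PG_eqP a b : PG a = PG b <->
  wcol a = wcol b /\ peak (link (wcol a)) (wperm a) =1 peak (link (wcol a)) (wperm b).
Proof.
rewrite (marks_eq _ _ PG_pos expand_PG); split=> -[cab E]; split=> //.
  move=> v; have [vn|vn] := ltnP v.+1 n; last first.
    have no_peak t : peak (link (wcol a)) t v = false.
      by apply/peakP => -[_ [w [_ wv _ _ _]]]; have := ltn_ord w; rewrite wv ltnNge vn.
    by rewrite !no_peak.
  have := E v.+1 vn; rewrite -[v.+1]/(val (Ordinal vn)) !(@pmark_peak _ v) // -cab.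
  case: eqVneq => //= gv _.
  have no_peak t : peak (link (wcol a)) t v = false.
    apply/peakP => -[_ [w [_ wv _ gw _]]]; move: gv.
    by have -> : Ordinal vn = w by [apply: val_inj]; rewrite gw eqxx.
  by rewrite !no_peak.
case=> [//|j] jn; have vn := ltnW jn.
by rewrite -[j.+1]/(val (Ordinal jn)) !(@pmark_peak _ (Ordinal vn)) // -cab E.
Qed.

(** Inside a block, a peak is a letter other than the first that is a descent while
    its predecessor is not, and descents are read off the marks of DG. *)
Lemma DG_PG a b : DG a = DG b -> PG a = PG b.
Proof.
move/(marks_eq _ _ DG_pos expand_DG) => [cab E].
apply/(marks_eq _ _ PG_pos expand_PG); split=> // j jn.
have cE i : i < n -> colour_at (coloured_word a) i = colour_at (coloured_word b) i.
  by move=> lt_in; rewrite -[i]/(val (Ordinal lt_in)) !colour_at_coloured cab.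
have := E j jn; rewrite /dmark /pmark.
case: j jn => [//|j] jn /=; rewrite !cE //; try lia.
case: eqVneq => //= cj ->.
case: j jn cj => [//|j] jn cj /=; have jn' := ltnW jn.
case: eqVneq => //= cj'; congr (_ && _).
have := E j.+1 jn'; rewrite /dmark /= !cE ?cj' ?eqxx /= ?(ltnW jn') //.
by rewrite !ltnNge => /negb_inj.
Qed.

End Classes.

(** * Products of elements constant on peak classes *)

Section Product.
Variables (n : nat) (G : finGroupType).
Implicit Types (a b : wreath n G) (g h : {ffun 'I_n -> G}) (s t : 'S_n) (i j : 'I_n).
Local Open Scope group_scope.

Definition swap i j : wreath n G := Wreath (tperm i j) [ffun=> 1].

Lemma swap_mul i j s g : swap i j * Wreath s g = Wreath (s * tperm i j) g.
Proof.
rewrite wreath_mulE; congr Wreath.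
by apply/ffunP => k; rewrite !ffunE mul1g.
Qed.

Lemma swapK i j b : swap i j * (swap i j * b) = b.
Proof. by case: b => s g; rewrite !swap_mul -mulgA tperm2 mulg1. Qed.

(** Exchanging two positions of the same colour on the right amounts to
    exchanging, on the left, the values that they carry. *)
Lemma mul_swap i j s g : g i = g j ->
  Wreath s g * swap i j = swap (s i) (s j) * Wreath s g.
Proof.
move=> gij; rewrite swap_mul wreath_mulE; congr Wreath.
  by rewrite conjgC tpermJ.
by apply/ffunP => k; rewrite !ffunE mulg1; case: tpermP => [->|->|].
Qed.

Definition movable i j b := free_swap (link (wcol b)) (wperm b) i j.

Lemma PG_swap i j b : movable i j b -> PG (swap i j * b) = PG b.
Proof.
case: b => s g mv; rewrite swap_mul; apply/PG_eqP; split=> //= v.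
by rewrite peak_swap //; apply: link_sym.
Qed.

Lemma movable_swap i j b : movable i j b -> movable i j (swap i j * b).
Proof.
case: b => s g; rewrite swap_mul; apply: free_swap_sym; exact: link_sym.
Qed.

(** If i and i+1 cannot be exchanged in b, they sit at linked positions p and q
    of b, and b^-1 (m a) = m' (b^-1 a) where m' exchanges the neighbouring values
    p and q. These stand in b^-1 a at the positions of i and i+1 in a, which are
    not linked in a. The colours at these two positions agree in a if and only
    if they agree in b^-1 a, because p and q have the same colour in b. So m' is
    a move for b^-1 a. *)
Lemma PG_mul_swap i j a b : movable i j a -> ~~ movable i j b ->
  PG (b^-1 * (swap i j * a)) = PG (b^-1 * a).
Proof.
case: a b => [s g] [t h] /andP[/= /eqP ji free].
rewrite /movable /free_swap /= ji eqxx negb_or negbK => /andP[i0 /andP[adj /eqP hij]].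
rewrite (negPf i0) /= in free.
set p := t^-1 i in adj hij *; set q := t^-1 j in adj hij *.
have -> : swap i j * Wreath s g = Wreath t h * (swap p q * ((Wreath t h)^-1 * Wreath s g)).
  by rewrite mulgA mul_swap // !permKV -mulgA mulKVg.
rewrite mulKg.
have nlink : ~~ link (wcol ((Wreath t h)^-1 * Wreath s g))
    ((wperm ((Wreath t h)^-1 * Wreath s g))^-1 p)
    ((wperm ((Wreath t h)^-1 * Wreath s g))^-1 q).
  apply: contra free => /=.
  rewrite /link /= !ffunE !invMg !invgK !permM !permKV -/p -/q hij.
  by case/andP=> -> /eqP /mulgI ->; rewrite eqxx.
case/orP: adj => /eqP pq.
  by apply: PG_swap; rewrite /movable /free_swap -pq eqxx nlink orbT.
rewrite /swap tpermC -/(swap q p).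
by apply: PG_swap; rewrite /movable /free_swap -pq eqxx link_sym nlink orbT.
Qed.

Local Open Scope ring_scope.

(** The sum defining the product is reindexed by the involution phi, which makes
    the corresponding terms of the two sums equal. *)
Lemma conv_swap (x y : zgalg (wreath n G)) i j a :
  (forall b c, PG b = PG c -> x b = x c) ->
  (forall b c, PG b = PG c -> y b = y c) ->
  movable i j a -> (x * y) (swap i j * a)%g = (x * y) a.
Proof.
move=> xP yP mv; rewrite !ffunE.
pose phi b := if movable i j b then (swap i j * b)%g else b.
have phiK : involutive phi.
  move=> b; rewrite /phi; case: (boolP (movable i j b)) => [mb|/negPf->//].
  by rewrite movable_swap // swapK.
rewrite (reindex_inj (inv_inj phiK)); apply: eq_bigr => b _.
rewrite /phi; case: ifP => [mb|/negbT mb].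
  by rewrite (xP _ _ (PG_swap mb)) invMg -mulgA mulKg.
by rewrite (yP _ _ (PG_mul_swap mv mb)).
Qed.

Lemma conv_PG (x y : zgalg (wreath n G)) :
  (forall b c, PG b = PG c -> x b = x c) ->
  (forall b c, PG b = PG c -> y b = y c) ->
  forall a b, PG a = PG b -> (x * y) a = (x * y) b.
Proof.
move=> xP yP [s g] [t h] /PG_eqP [/= <- {h} pst].
have r := reach_peak (@link_sym _ _ g) (@link_irr _ _ g) (@link_deg _ _ g) pst.
elim: r => // {s pst}s {}t i j _ mv _ <-.
by rewrite -swap_mul conv_swap.
Qed.

End Product.

Theorem theorem2p12 (G : finGroupType) (abG : abelian [set: G]) (n : nat) :
  [/\ Zfree (@PiG n G) (@pG n G),
      forall x : zgalg (wreath n G),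
        interior_peak_module x -> MR_algebra x
    & nonunital_subring (@interior_peak_module n G)].
Proof.
have Pi_PG (a : wreath n G) : PiG n (PG a) by apply/existsP; exists a.
have PP x : interior_peak_module x <->
    (forall a b : wreath n G, PG a = PG b -> x a = x b).
  exact: span_fibre_sums.
split.
- by apply: free_fibre_sums => c /existsP[a /eqP <-]; exists a.
- move=> x /PP xP; apply/(span_fibre_sums x (@DG_Gcomp n G)) => a b /DG_PG; exact: xP.
split.
- by apply/PP => a b _; rewrite !ffunE.
- move=> x y /PP xP /PP yP; apply/PP => a b ab.
  by rewrite !ffunE (xP a b) // (yP a b).
by move=> x y /PP xP /PP yP; apply/PP; apply: conv_PG.
Qed.
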